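(* Let $G$ be a finite digraph without oriented cycles. Then the multipath complex $X(G)$ is isomorphic, as a simplicial complex, to a join $M(H_1)\ast\cdots\ast M(H_n)$ of matching complexes of (undirected) bipartite graphs $H_1,\dots,H_n$.
   Context: A quiver consists of finite sets $V$ (vertices), $E$ (edges) and maps $s,t\colon E\to V$ (source, target). A digraph is a quiver in which each edge $e$ is determined by the ordered pair $(s(e),t(e))$. A simple path is a subquiver whose edges can be ordered $e_1,\dots,e_n$ such that (i) $s(e_{i+1})=t(e_i)$ for $i<n$, (ii) $s(e_i)=s(e_j)$ or $t(e_i)=t(e_j)$ implies $i=j$, and (iii) $s(e_1)\ne t(e_n)$. An oriented cycle is a subquiver satisfying (i) and (ii) but not (iii) (in particular a self-loop is an oriented cycle). A multipath of $G$ is a spanning subquiver (same vertex set) each of whose connected components is either a single vertex or a simple path. The multipath complex $X(G)$ is the simplicial complex whose simplices are the sets of edges of multipaths of $G$ (the multipath without edges corresponding to the empty simplex). For an undirected graph $H$, the matching complex $M(H)$ is the simplicial complex whose simplices are the sets of pairwise vertex-disjoint edges of $H$. $\ast$ denotes the join of simplicial complexes. *)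

(* Defs.v *)
From mathcomp Require Import all_boot.

Set Implicit Arguments.
Unset Strict Implicit.
Unset Printing Implicit Defensive.

(** * Quivers *)

Record quiver := Quiver {
  vert : finType;
  edge : finType;
  src : edge -> vert;
  tgt : edge -> vert
}.

Definition is_digraph (G : quiver) : Prop :=
  injective (fun e : edge G => (src e, tgt e)).

Record subquiver (G : quiver) := Subquiver {
  sub_vert : {set vert G};
  sub_edge : {set edge G};
  sub_closed : forall e, e \in sub_edge ->
    (src e \in sub_vert) && (tgt e \in sub_vert)
}.

Section Subquivers.
Variable G : quiver.
Implicit Types (P : subquiver G) (v w : vert G) (e f : edge G).
Implicit Types (p : seq (edge G)) (A B : {set edge G}).

(* [e_1; ...; e_n] with t(e_i) = s(e_{i+1}), pairwise distinct sources and
   pairwise distinct targets. *)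
Definition chain_ordered p :=
  [&& sorted (fun e f => tgt e == src f) p,
      uniq (map (@src G) p) & uniq (map (@tgt G) p)].

(* t(e_n) = s(e_1). *)
Definition closed_up p :=
  if p is e :: p' then src e == tgt (last e p') else false.

(* [permutations (enum A)] lists all the orderings of the finite set A. The
   condition s(e_1) != t(e_n) presupposes at least one edge. *)
Definition is_simple_path P : bool :=
  (sub_edge P != set0) &&
  has (fun p => chain_ordered p && ~~ closed_up p)
      (permutations (enum (sub_edge P))).

Definition is_oriented_cycle P : bool :=
  (sub_edge P != set0) &&
  has (fun p => chain_ordered p && closed_up p)
      (permutations (enum (sub_edge P))).

Definition is_single_vertex P : bool :=
  (#|sub_vert P| == 1) && (sub_edge P == set0).

(* Undirected adjacency through an edge of P. *)
Definition adjacent P : rel (vert G) := fun v w =>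
  [exists e in sub_edge P, ((src e == v) && (tgt e == w))
                           || ((src e == w) && (tgt e == v))].

Definition component_vert P v : {set vert G} :=
  [set w | connect (adjacent P) v w].

Definition component_edge P v : {set edge G} :=
  [set e in sub_edge P | src e \in component_vert P v].

Lemma adjacent_edge P e : e \in sub_edge P -> adjacent P (src e) (tgt e).
Proof. by move=> eP; apply/existsP; exists e; rewrite eP !eqxx. Qed.

Lemma adjacent_sym P : symmetric (adjacent P).
Proof. by move=> v w; apply: eq_existsb => e; rewrite orbC. Qed.

Lemma component_closed P v e : e \in component_edge P v ->
  (src e \in component_vert P v) && (tgt e \in component_vert P v).
Proof.
rewrite !inE => /andP[eP ve]; rewrite ve /=.
exact: connect_trans ve (connect1 (adjacent_edge eP)).
Qed.

(* The connected component of P containing v, for v a vertex of P. *)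
Definition component P v : subquiver G := Subquiver (@component_closed P v).

Lemma spanning_closed A e : e \in A ->
  (src e \in [set: vert G]) && (tgt e \in [set: vert G]).
Proof. by rewrite !inE. Qed.

Definition spanning A : subquiver G := Subquiver (@spanning_closed A).

Definition is_multipath P : bool :=
  (sub_vert P == [set: vert G]) &&
  [forall v in sub_vert P,
     is_single_vertex (component P v) || is_simple_path (component P v)].

End Subquivers.

(** * Finite simplicial complexes *)

(* The carrier may contain elements that are not vertices: x is a vertex when
   [set x] is a simplex. The empty set is a simplex. *)
Record scomplex := SComplex {
  carrier : finType;
  simplices : {set {set carrier}};
  simplices0 : set0 \in simplices;
  simplicesS : forall A B : {set carrier},
    B \subset A -> A \in simplices -> B \in simplices
}.

Definition vertex (K : scomplex) : finType :=
  {x : carrier K | [set x] \in simplices K}.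

Definition scomplex_iso (K L : scomplex) : Prop :=
  exists2 f : vertex K -> vertex L, bijective f &
    forall A : {set vertex K},
      ([set val x | x in A] \in simplices K)
      = ([set val (f x) | x in A] \in simplices L).

(** * Joins *)

Section Join.
Variables (I : finType) (K : I -> scomplex).

Definition join_carrier : finType := {i : I & carrier (K i)}.

Definition join_part (i : I) (A : {set join_carrier}) : {set carrier (K i)} :=
  [set x | Tagged (fun j => carrier (K j)) x \in A].

(* The simplices are the disjoint unions of one (possibly empty) simplex of
   each K i. *)
Definition join_simplices : {set {set join_carrier}} :=
  [set A | [forall i, join_part i A \in simplices (K i)]].

Lemma join_simplices0 : set0 \in join_simplices.
Proof.
rewrite inE; apply/forallP => i; suff -> : join_part i set0 = set0.
  exact: simplices0.
by apply/setP => x; rewrite !inE.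
Qed.

Lemma join_simplicesS (A B : {set join_carrier}) :
  B \subset A -> A \in join_simplices -> B \in join_simplices.
Proof.
move=> /subsetP sBA; rewrite !inE => /forallP hA; apply/forallP => i.
by apply: simplicesS (hA i); apply/subsetP => x; rewrite !inE => /sBA.
Qed.

Definition join : scomplex := SComplex join_simplices0 join_simplicesS.
End Join.

(** * Matching complexes *)

Record sgraph := SGraph {
  node : finType;
  adj : rel node;
  adj_sym : symmetric adj;
  adj_irrefl : irreflexive adj
}.

Definition bipartite (H : sgraph) : Prop :=
  exists c : node H -> bool, forall x y, adj x y -> c x != c y.

Section Matching.
Variable H : sgraph.

Definition graph_edges : {set {set node H}} :=
  [set a | [exists x, exists y, adj x y && (a == [set x; y])]].

Definition matchings : {set {set {set node H}}} :=
  [set M : {set {set node H}} | (M \subset graph_edges) && trivIset M].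

Lemma matchings0 : set0 \in matchings.
Proof. by rewrite inE sub0set; apply/trivIsetP => A B; rewrite inE. Qed.

Lemma matchingsS (M N : {set {set node H}}) :
  N \subset M -> M \in matchings -> N \in matchings.
Proof.
move=> sNM; rewrite !inE => /andP[sM tM].
by rewrite (subset_trans sNM sM) (trivIsetS sNM tM).
Qed.

Definition matching_complex : scomplex := SComplex matchings0 matchingsS.
End Matching.

(** * Multipath complexes *)

Section Multipath.
Variable G : quiver.
Implicit Types (A B : {set edge G}) (e f g h : edge G) (p q r : seq (edge G)).

Definition multipaths : {set {set edge G}} :=
  [set A | is_multipath (spanning A)].

Lemma component_edgeless P v :
  component_edge P v = set0 -> is_single_vertex (component P v : subquiver G).
Proof.
move=> C0; rewrite /is_single_vertex /= C0 eqxx andbT.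
apply/cards1P; exists v; apply/setP => w; rewrite !inE.
apply/idP/eqP => [/connectP[[|u p] //= /andP[vu _] _]|->]; last exact: connect0.
have /existsP[e /andP[eP hv]] := vu.
suff : e \in component_edge P v by rewrite C0 inE.
rewrite !inE eP /=; case/orP: hv => /andP[/eqP es _]; rewrite es.
  exact: connect0.
exact: connect1.
Qed.

Lemma uniq_map_inj (T U : eqType) (k : T -> U) (s : seq T) :
  uniq (map k s) -> {in s &, injective k}.
Proof.
elim: s => [|x s IHs] //= /andP[xs us] a b; rewrite !inE.
case/predU1P=> [->|ai] /predU1P[->|bi] // kab; last exact: IHs kab.
- by case/negP: xs; rewrite kab map_f.
- by case/negP: xs; rewrite -kab map_f.
Qed.

Lemma split_prefix (T : Type) (a : pred T) (s : seq T) :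
  exists q r : seq T, [/\ s = q ++ r, all a q & if r is g :: _ then ~~ a g else true].
Proof.
elim: s => [|x s [q [r [-> hq hr]]]]; first by exists [::], [::].
case ax: (a x); first by exists (x :: q), r; rewrite /= ax.
by exists [::], (x :: q ++ r); rewrite /= ax.
Qed.

Lemma path_tgt e p h :
  path (fun e f => tgt e == src f) e p -> h \in e :: p ->
  h = last e p \/ exists2 g, g \in p & src g = tgt h.
Proof.
elim: p e => [|f p IHp] e /=; first by rewrite inE => _ /eqP; left.
case/andP=> /eqP ef fp; rewrite inE => /predU1P[->|hp].
  by right; exists f; rewrite ?mem_head.
by case: (IHp f fp hp) => [|[g gp]]; [left|right; exists g; rewrite // inE gp orbT].
Qed.

Lemma path_src e p h :
  path (fun e f => tgt e == src f) e p -> h \in p ->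
  exists2 g, g \in belast e p & tgt g = src h.
Proof.
elim: p e => [|f p IHp] e //= /andP[/eqP ef fp]; rewrite inE => /predU1P[->|hp].
  by exists e; rewrite ?mem_head.
by have [g gp gh] := IHp f fp hp; exists g; rewrite // inE gp orbT.
Qed.

Lemma open_last p h :
  sorted (fun e f => tgt e == src f) p -> uniq (map (@tgt G) p) ->
  ~~ closed_up p -> h \in p -> src h != tgt (last h p).
Proof.
case: p => //= x l p_path p_tgt p_open; rewrite inE => /predU1P[->|] //.
case/(path_src p_path)=> g gb <-; apply/eqP => gl.
have E := lastI x l.
move: (p_tgt); rewrite -[_ && _]/(uniq (map (@tgt G) (x :: l))) E map_rcons.
by rewrite rcons_uniq -gl map_f.
Qed.

Lemma component_sub_path A B v :
  B \subset A -> component_edge (spanning B) v != set0 ->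
  is_simple_path (component (spanning A) v) ->
  is_simple_path (component (spanning B) v).
Proof.
move=> /subsetP sBA C0 /andP[_ /hasP[/= p]]; rewrite mem_permutations => pA.
case/andP=> /and3P[p_path p_src p_tgt] p_open.
rewrite /is_simple_path /= C0 /=.
set C := component_edge _ v in C0 *.
have CP h : h \in C = (h \in B) && connect (adjacent (spanning B)) v (src h).
  by rewrite !inE.
have CT h : h \in C -> connect (adjacent (spanning B)) v (tgt h).
  by move/component_closed; rewrite !inE => /andP[].
have sAB x y : connect (adjacent (spanning B)) x y ->
               connect (adjacent (spanning A)) x y.
  apply: connect_sub => {}x {}y /existsP[e /andP[eB exy]].
  by apply: connect1; apply/existsP; exists e; rewrite (sBA _ eB).
have Cp h : h \in C -> h \in p.
  rewrite (perm_mem pA) mem_enum CP !inE => /andP[hB hv].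
  by rewrite /= (sBA _ hB) sAB.
have srcI := uniq_map_inj p_src; have tgtI := uniq_map_inj p_tgt.
have up := map_uniq p_src.
have [p1 [s [def_p p1C hs]]] := split_prefix (fun e => e \notin C) p.
have {p1C} p1C h : h \in p1 -> h \notin C by move=> hp; apply: (allP p1C).
case: s => [|e s] in def_p hs *.
  have [h hC] := set0Pn _ C0; have := Cp _ hC.
  by rewrite def_p cats0 => /p1C; rewrite hC.
have {hs} eC : e \in C by rewrite negbK in hs.
have [q [r [def_s qC hr]]] := split_prefix (fun e => e \in C) s.
have {}qC h : h \in e :: q -> h \in C.
  by rewrite inE => /predU1P[->|] //; apply: (allP qC).
rewrite {s}def_s in def_p.
have ep : path (fun e f => tgt e == src f) e (q ++ r).
  by move: p_path; rewrite def_p; case: (p1) => [|g l] //=; rewrite cat_path => /and3P[].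
have memp h : (h \in p) = [|| h \in p1, h \in e :: q | h \in r].
  by rewrite def_p -cat_cons !mem_cat.
have qp h : h \in e :: q -> h \in p by rewrite memp => ->; rewrite orbT.
have eq : path (fun e f => tgt e == src f) e q by move: ep; rewrite cat_path => /andP[].
have uep : e \notin q ++ r.
  by move: up; rewrite def_p cat_uniq /= => /and4P[].
have no_pred h : h \in C -> tgt h != src e.
  move=> hC; apply/eqP => the; have hp := Cp _ hC.
  case/lastP: p1 => [|l g] in def_p p1C memp.
    rewrite def_p in p_open hp; have [h_last|[g gqr]] := path_tgt ep hp.
      by case/negP: p_open; rewrite /= -h_last the.
    rewrite the => /srcI ge; case/negP: uep; rewrite -ge //.
      by rewrite memp; rewrite mem_cat in gqr; case/orP: gqr => gi; rewrite ?inE gi !orbT.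
    by rewrite memp mem_head orbT.
  have gl : g \in rcons l g by rewrite mem_rcons mem_head.
  have gp : g \in p by rewrite memp gl.
  have tge : tgt g = src e.
    move: p_path; rewrite def_p cat_rcons; case: (l) => [|x l'] /=.
      by case/andP=> /eqP.
    by rewrite cat_path /= => /and3P[_ _ /andP[/eqP]].
  by case/negP: (p1C g gl); rewrite (tgtI g h) // tge.
have no_succ h : h \in C -> src h != tgt (last e q).
  move=> hC; apply/eqP => the; have hp := Cp _ hC.
  case: r => [|g r] in def_p ep hr memp uep.
    have p_last : last h p = last e q by rewrite def_p cats0 last_cat.
    by case/negP: (open_last p_path p_tgt p_open hp); rewrite p_last the.
  have tg : tgt (last e q) = src g by move: ep; rewrite cat_path /= => /and3P[_ /eqP].
  case/negP: hr; rewrite (srcI g h) //; last by rewrite the.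
  by rewrite memp mem_head !orbT.
pose W := src e |: [set tgt f | f in e :: q].
have WP x : reflect (x = src e \/ exists2 f, f \in e :: q & x = tgt f) (x \in W).
  rewrite !inE; apply: (iffP orP) => -[].
  - by move/eqP; left.
  - by case/imsetP=> f; right; exists f.
  - by move->; left.
  - by case=> f fq ->; right; apply: imset_f.
have src_q h : h \in C -> src h \in W -> h \in e :: q.
  move=> hC /WP[he|[f fq hf]].
    by rewrite (srcI h e) ?mem_head ?Cp.
  have [f_last|[g gq gf]] := path_tgt eq fq.
    by case/negP: (no_succ h hC); rewrite hf f_last.
  have geq : g \in e :: q by rewrite inE gq orbT.
  by rewrite (srcI h g (Cp _ hC) (qp _ geq)) // hf.
have tgt_q h : h \in C -> tgt h \in W -> h \in e :: q.
  move=> hC /WP[he|[f fq hf]]; first by case/negP: (no_pred h hC); rewrite he.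
  by rewrite (tgtI h f (Cp _ hC) (qp _ fq)).
have q_srcW h : h \in e :: q -> src h \in W.
  rewrite inE => /predU1P[->|/(path_src eq)[g gb <-]]; first exact: setU11.
  by apply/WP; right; exists g => //; rewrite lastI mem_rcons inE gb orbT.
have q_tgtW h : h \in e :: q -> tgt h \in W by move=> hq; apply/WP; right; exists h.
have W_conn x : x \in W -> connect (adjacent (spanning B)) v x.
  case/WP=> [->|[f /qC/CT fv ->]] //.
  by move: eC; rewrite CP => /andP[].
have symB : connect_sym (adjacent (spanning B)).
  exact/sym_connect_sym/adjacent_sym.
have W_closed : closed (adjacent (spanning B)) W.
  apply: intro_closed => // x y xy xW.
  have vx := W_conn _ xW.
  have /existsP[h /= /andP[hB]] := xy.
  case/orP=> /andP[/eqP hx /eqP hy]; subst x y.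
    by apply/q_tgtW/src_q; rewrite // CP hB.
  apply/q_srcW/tgt_q; rewrite // CP hB /=.
  exact: connect_trans vx (connect1 xy).
have Cq h : (h \in C) = (h \in e :: q).
  apply/idP/idP=> [hC|/qC //]; apply: src_q => //.
  have vh : connect (adjacent (spanning B)) v (src h) by move: hC; rewrite CP => /andP[].
  have ve : connect (adjacent (spanning B)) v (src e) by apply/W_conn/setU11.
  by rewrite -(closed_connect W_closed vh) (closed_connect W_closed ve) setU11.
apply/hasP; exists (e :: q).
  rewrite mem_permutations; apply: uniq_perm; rewrite ?enum_uniq //.
    by move: up; rewrite def_p -cat_cons !cat_uniq => /and3P[_ _ /and3P[]].
  by move=> h; rewrite mem_enum Cq.
rewrite /= eq_sym (no_pred (last e q)) ?andbT; last exact/qC/mem_last.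
rewrite /chain_ordered [sorted _ _]eq -![uniq (map _ _)]/(uniq (map _ (e :: q))) /=.
move: p_src p_tgt; rewrite def_p -cat_cons !map_cat !cat_uniq.
by case/and3P=> _ _ /and3P[/= -> _ _] /and3P[_ _ /and3P[/= -> _ _]].
Qed.

Lemma multipaths0 : set0 \in multipaths.
Proof.
rewrite inE /is_multipath eqxx; apply/forall_inP => v _.
by rewrite component_edgeless //; apply/setP => e; rewrite !inE.
Qed.

Lemma multipathsS A B : B \subset A -> A \in multipaths -> B \in multipaths.
Proof.
move=> sBA; rewrite !inE => /andP[_ /forall_inP mA].
rewrite /is_multipath eqxx; apply/forall_inP => v _.
have [/component_edgeless -> //|C0] := eqVneq (component_edge (spanning B) v) set0.
rewrite (component_sub_path sBA C0) ?orbT //.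
have := mA v (in_setT v); case/orP=> // /andP[_ /= /eqP A0].
have [e] := set0Pn _ C0; rewrite !inE /= => /andP[eB ve].
suff: e \in component_edge (spanning A) v by rewrite A0 inE.
rewrite !inE /= (subsetP sBA) //=; move: ve; apply: connect_sub => x y.
case/existsP=> f /andP[fB fxy].
by apply: connect1; apply/existsP; exists f; rewrite /= (subsetP sBA).
Qed.

Definition multipath_complex : scomplex := SComplex multipaths0 multipathsS.
End Multipath.

(* Main.v *)
Require Import Defs.
From mathcomp Require Import all_boot.

Set Implicit Arguments.
Unset Strict Implicit.
Unset Printing Implicit Defensive.

(** One graph suffices: let [H] have two copies [(v, false)] and [(v, true)] of
    each vertex [v] of [G], and let an edge [e] of [G] become the edge joining
    [(src e, false)] to [(tgt e, true)]. A set of edges is a matching of [H] iff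
    its sources are pairwise distinct and its targets are pairwise distinct. A
    set of edges with this property has only simple paths and oriented cycles
    as nontrivial components, so if [G] has no oriented cycles it is a
    multipath. *)

Section SplitGraph.
Variable G : quiver.
Implicit Types (e f : edge G) (A : {set edge G}) (p q : vert G * bool).

Definition split_adj : rel (vert G * bool) := fun p q =>
  [exists e : edge G, ((p == (src e, false)) && (q == (tgt e, true)))
                   || ((q == (src e, false)) && (p == (tgt e, true)))].

Lemma split_adj_sym : symmetric split_adj.
Proof. by move=> p q; apply: eq_existsb => e; rewrite orbC. Qed.

(** The Boolean component is a 2-colouring of the nodes; this yields both irreflexivity and
    bipartiteness. *)
Lemma split_adj_color p q : split_adj p q -> p.2 != q.2.
Proof. by case/existsP=> e /orP[] /andP[/eqP-> /eqP->]. Qed.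

Lemma split_adj_irrefl : irreflexive split_adj.
Proof. by move=> p; apply: contraTF isT => /split_adj_color; rewrite eqxx. Qed.

Definition split_graph : sgraph := SGraph split_adj_sym split_adj_irrefl.

Lemma split_graph_bipartite : bipartite split_graph.
Proof. by exists snd => p q; apply: split_adj_color. Qed.

Definition split_edge e : {set node split_graph} :=
  [set (src e, false); (tgt e, true)].

Lemma split_edge_src e v : ((v, false) \in split_edge e) = (v == src e).
Proof. by rewrite !inE !xpair_eqE !andbF andbT orbF. Qed.

Lemma split_edge_tgt e v : ((v, true) \in split_edge e) = (v == tgt e).
Proof. by rewrite !inE !xpair_eqE andbF andbT. Qed.

(** The [false] node of a split edge recovers the source and the [true] node the target, and in a
    digraph these two determine the edge. *)
Lemma split_edge_inj : is_digraph G -> injective split_edge.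
Proof.
move=> digraphG e f ef; apply: digraphG.
have /eqP-> : src e == src f by rewrite -split_edge_src -ef split_edge_src.
by have /eqP-> : tgt e == tgt f by rewrite -split_edge_tgt -ef split_edge_tgt.
Qed.

Lemma graph_edges_split (a : {set node split_graph}) :
  reflect (exists e, a = split_edge e) (a \in graph_edges split_graph).
Proof.
rewrite inE; apply: (iffP existsP) => [[p /existsP[q]]|[e ->]].
  case/andP=> /existsP[e] /orP[] /andP[/eqP-> /eqP->] /eqP->; exists e => //.
  by rewrite setUC.
exists (src e, false); apply/existsP; exists (tgt e, true).
by rewrite eqxx andbT; apply/existsP; exists e; rewrite !eqxx.
Qed.

(** Two split edges can meet only in a [false] node, that is, a common source, or in a [true] node,
    a common target. *)
Lemma split_matchingP A : is_digraph G ->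
  reflect ({in A &, injective (@src G)} /\ {in A &, injective (@tgt G)})
          ([set split_edge e | e in A] \in matchings split_graph).
Proof.
move=> digraphG; have sI := split_edge_inj digraphG.
rewrite inE; have -> : [set split_edge e | e in A] \subset graph_edges split_graph.
  by apply/subsetP => _ /imsetP[e _ ->]; apply/graph_edges_split; exists e.
apply: (iffP trivIsetP) => [dA | [srcI tgtI] _ _ /imsetP[e eA ->] /imsetP[f fA ->] ef].
  suff meet e f p : e \in A -> f \in A -> p \in split_edge e ->
      p \in split_edge f -> e = f.
    split=> e f eA fA ef; [apply: (meet e f (src e, false)) => //
                          |apply: (meet e f (tgt e, true)) => //].
    - by rewrite split_edge_src.
    - by rewrite split_edge_src ef.
    - by rewrite split_edge_tgt.
    - by rewrite split_edge_tgt ef.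
  move=> eA fA pe pf; apply/eqP/negPn/negP => nef.
  have := dA _ _ (imset_f split_edge eA) (imset_f split_edge fA).
  rewrite (inj_eq sI) => /(_ nef); rewrite disjoint_subset => /subsetP/(_ p pe).
  by rewrite inE pf.
rewrite disjoint_subset; apply/subsetP => -[v b] ve; rewrite inE.
apply: contraNN ef => vf; apply/eqP; congr split_edge.
case: b ve vf; rewrite ?split_edge_src ?split_edge_tgt => /eqP-> /eqP.
  exact: tgtI.
exact: srcI.
Qed.

End SplitGraph.

(** Duplicate-free sequences over [T] have length at most [#|T|], so the lengths attained have a
    maximum. *)
Lemma exists_longest (T : finType) (P : pred (seq T)) (p0 : seq T) :
  P p0 -> (forall p, P p -> uniq p) ->
  exists2 p, P p & forall q, P q -> size q <= size p.
Proof.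
move=> Pp0 Pu.
have exP : exists n, [exists t : n.-tuple T, P t].
  by exists (size p0); apply/existsP; exists (in_tuple p0).
have leP n : [exists t : n.-tuple T, P t] -> n <= #|T|.
  by case/existsP=> t /Pu/card_uniqP; rewrite size_tuple => <-; apply: max_card.
case: (ex_maxnP exP leP) => n /existsP[t Pt] maxn; exists t => // q Pq.
by rewrite size_tuple; apply: maxn; apply/existsP; exists (in_tuple q).
Qed.

(** * Multipaths characterized by injectivity of source and target *)

Section Multipaths.
Variable G : quiver.
Implicit Types (e f h : edge G) (A : {set edge G}) (p : seq (edge G)).

(** Edges sharing a source or a target lie in one component, which has an edge and is therefore a
    simple path. *)
Lemma multipath_inj A : A \in multipaths G ->
  {in A &, injective (@src G)} /\ {in A &, injective (@tgt G)}.
Proof.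
rewrite inE => /andP[_ /forall_inP mA].
have path_inj v e f :
    e \in component_edge (spanning A) v -> f \in component_edge (spanning A) v ->
    (src e = src f -> e = f) /\ (tgt e = tgt f -> e = f).
  move=> ev fv; case/orP: (mA v (in_setT v)) => /andP[].
    by move=> _ /eqP /= C0; rewrite C0 inE in ev.
  move=> _ /hasP[p]; rewrite mem_permutations => pC.
  have memp h : h \in component_edge (spanning A) v -> h \in p.
    by rewrite (perm_mem pC) mem_enum.
  case/andP=> /and3P[_ srcU tgtU] _.
  by split; [apply: (uniq_map_inj srcU)|apply: (uniq_map_inj tgtU)]; apply: memp.
have symA : connect_sym (adjacent (spanning A)).
  exact/sym_connect_sym/adjacent_sym.
(* [component_edge] tests the source of an edge, so [e] itself has to be crossed backwards from its
   target. *)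
have in_tgt e : e \in A -> e \in component_edge (spanning A) (tgt e).
  move=> eA; rewrite !inE /= eA symA; apply: connect1.
  exact: (@adjacent_edge _ (spanning A)).
split=> e f eA fA ef.
  have in_src h : h \in A -> h \in component_edge (spanning A) (src h).
    by move=> hA; rewrite !inE /= hA connect0.
  have fe : f \in component_edge (spanning A) (src e) by rewrite ef in_src.
  by have [-> //] := path_inj _ _ _ (in_src e eA) fe.
have fe : f \in component_edge (spanning A) (tgt e) by rewrite ef in_tgt.
by have [_ ->] := path_inj _ _ _ (in_tgt e eA) fe.
Qed.

Lemma inj_multipath A : (forall C : subquiver G, ~~ is_oriented_cycle C) ->
  {in A &, injective (@src G)} -> {in A &, injective (@tgt G)} ->
  A \in multipaths G.
Proof.
move=> acyclicG srcI tgtI; rewrite inE /is_multipath eqxx /=.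
apply/forall_inP => v _.
have [/component_edgeless -> //|C0] := eqVneq (component_edge (spanning A) v) set0.
apply/orP; right; rewrite /is_simple_path /= C0 /=.
set C := component_edge _ v in C0 *; have [e0 e0C] := set0Pn _ C0.
pose nxt : rel (edge G) := fun e f => tgt e == src f.
have symA : connect_sym (adjacent (spanning A)).
  exact/sym_connect_sym/adjacent_sym.
have CP h : (h \in C) = (h \in A) && connect (adjacent (spanning A)) v (src h).
  by rewrite !inE.
have CA h : h \in C -> h \in A by rewrite CP => /andP[].
have CT h : h \in C -> connect (adjacent (spanning A)) v (tgt h).
  by move/component_closed; rewrite !inE => /andP[].
(* Distinct edges are enough here: distinct sources and targets follow from [srcI] and [tgtI], since
   [C] lies in [A]. *)
pose P p := [&& sorted nxt p, uniq p & all (mem C) p].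
have Pu p : P p -> uniq p by case/and3P.
have P0 : P [:: e0] by rewrite /P /= e0C.
(* By maximality no edge of C leaves the vertex set W of a longest path in C, so
   the path exhausts C. *)
have [[|e p] Pp pmax] := exists_longest P0 Pu.
  by have := pmax _ P0.
have /and3P[ep up pCb] := Pp; rewrite /= in ep.
have pC h : h \in e :: p -> h \in C by apply: (allP pCb).
have pA h : h \in e :: p -> h \in A by move/pC/CA.
have chain_p : chain_ordered (e :: p).
  apply/and3P; split=> //; rewrite map_inj_in_uniq // => f g /pA fA /pA gA.
    exact: srcI.
  exact: tgtI.
(* [W] is the set of vertices visited by the chain. *)
pose W := src e |: [set tgt f | f in e :: p].
have WP x : reflect (x = src e \/ exists2 f, f \in e :: p & x = tgt f) (x \in W).
  rewrite !inE; apply: (iffP orP) => -[].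
  - by move/eqP; left.
  - by case/imsetP=> f; right; exists f.
  - by move->; left.
  - by case=> f fp ->; right; apply: imset_f.
have W_conn x : x \in W -> connect (adjacent (spanning A)) v x.
  case/WP=> [->|[f /pC/CT fv ->]] //.
  by have := pC e (mem_head _ _); rewrite CP => /andP[].
(* An edge leaving a visited vertex other than the end of the chain equals the chain edge leaving
   it; one leaving the end and not in the chain could be appended. *)
have srcW h : h \in C -> src h \in W -> h \in e :: p.
  move=> hC /WP[he|[f fp hf]].
    by rewrite (srcI h e (CA _ hC) (pA _ (mem_head e p)) he) mem_head.
  have [f_last|[g gp gf]] := path_tgt ep fp; last first.
    have gp' : g \in e :: p by rewrite inE gp orbT.
    by rewrite (srcI h g (CA _ hC) (pA _ gp')) // gf.
  apply/negPn/negP => hp.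
  suff /pmax : P (rcons (e :: p) h) by rewrite size_rcons ltnn.
  apply/and3P; split; last by rewrite all_rcons pCb andbT.
    by rewrite /= rcons_path ep /nxt -f_last hf eqxx.
  by rewrite rcons_uniq hp up.
(* Dually, an edge entering the start of the chain could be prepended. *)
have tgtW h : h \in C -> tgt h \in W -> h \in e :: p.
  move=> hC /WP[he|[f fp hf]]; last by rewrite (tgtI h f (CA _ hC) (pA _ fp) hf).
  apply/negPn/negP => hp.
  suff /pmax : P (h :: e :: p) by rewrite /= ltnn.
  apply/and3P; split; last by apply/andP.
    by rewrite /= /nxt he eqxx.
  by rewrite cons_uniq hp up.
have p_srcW h : h \in e :: p -> src h \in W.
  rewrite inE => /predU1P[->|/(path_src ep)[g gb <-]]; first exact: setU11.
  by apply/WP; right; exists g => //; rewrite lastI mem_rcons inE gb orbT.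
have p_tgtW h : h \in e :: p -> tgt h \in W by move=> hp; apply/WP; right; exists h.
have W_closed : closed (adjacent (spanning A)) W.
  apply: intro_closed => // x y xy xW; have vx := W_conn _ xW.
  have /existsP[h /= /andP[hA]] := xy.
  case/orP=> /andP[/eqP hx /eqP hy]; subst x y.
    by apply/p_tgtW/srcW; rewrite // CP hA.
  apply/p_srcW/tgtW; rewrite // CP hA /=.
  exact: connect_trans vx (connect1 xy).
(* Being closed under adjacency and containing [src e], [W] contains every vertex of the component
   of [v]. *)
have Cp h : (h \in C) = (h \in e :: p).
  apply/idP/idP=> [hC|/pC //]; apply: srcW => //.
  have vh : connect (adjacent (spanning A)) v (src h) by move: hC; rewrite CP => /andP[].
  have ve := W_conn _ (setU11 (src e) _).
  by rewrite -(closed_connect W_closed vh) (closed_connect W_closed ve) setU11.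
have p_perm : e :: p \in permutations (enum C).
  by rewrite mem_permutations uniq_perm ?enum_uniq // => h; rewrite mem_enum Cp.
apply/hasP; exists (e :: p); rewrite // chain_p /=.
(* If the chain closed up, the component would be an oriented cycle. *)
apply: contraNN (acyclicG (component (spanning A) v)) => p_closed.
rewrite /is_oriented_cycle /= C0 /=; apply/hasP; exists (e :: p) => //.
by rewrite chain_p.
Qed.

Lemma multipaths_matchings A :
  is_digraph G -> (forall C : subquiver G, ~~ is_oriented_cycle C) ->
  (A \in multipaths G) = ([set split_edge e | e in A] \in matchings (split_graph G)).
Proof.
move=> digraphG acyclicG; apply/idP/(split_matchingP _ digraphG).
  exact: multipath_inj.
by case; apply: inj_multipath.
Qed.

End Multipaths.

(** * Joins over one index and the isomorphism *)

Lemma join_ord1 (K : 'I_1 -> scomplex) (A : {set join_carrier K}) :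
  (A \in simplices (join K)) = (join_part ord0 A \in simplices (K ord0)).
Proof.
rewrite inE; apply/forallP/idP => [/(_ ord0) //|KA i].
by rewrite (ord1 i).
Qed.

Lemma join_part_imset (I : finType) (K : I -> scomplex) (i : I)
    (A : {set carrier (K i)}) :
  join_part i [set (Tagged (fun j => carrier (K j)) x : join_carrier K) | x in A] = A.
Proof.
apply/setP => x; rewrite inE; apply/imsetP/idP => [[y yA xy]|xA]; last by exists x.
suff -> : x = y by [].
by apply/eqP; move/eqP: xy; rewrite -tag_eqE /tag_eq eqxx tagged_asE.
Qed.

Theorem theorem1p2 (G : quiver) (digraphG : is_digraph G)
  (acyclicG : forall C : subquiver G, ~~ is_oriented_cycle C) :
  exists (n : nat) (H : 'I_n -> sgraph),
    [/\ 0 < n,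
        forall i, bipartite (H i) &
        scomplex_iso (multipath_complex G)
                     (join (fun i => matching_complex (H i)))].
Proof.
exists 1, (fun=> split_graph G); split=> // [i|]; first exact: split_graph_bipartite.
set K := fun i : 'I_1 => matching_complex (split_graph G).
pose tag_in i (a : carrier (K i)) : join_carrier K := Tagged (fun j => carrier (K j)) a.
pose t (e : edge G) := tag_in ord0 (split_edge e).
have tE (A : {set edge G}) :
    (A \in multipaths G) = ([set t e | e in A] \in simplices (join K)).
  rewrite join_ord1 multipaths_matchings //.
  rewrite (imset_comp (tag_in ord0) (@split_edge G)).
  by rewrite join_part_imset.
have t_inj : injective t.
  move=> e f /eqP; rewrite -tag_eqE /tag_eq eqxx tagged_asE => /eqP.
  exact: split_edge_inj.
have tV (x : vertex (multipath_complex G)) : [set t (val x)] \in simplices (join K).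
  by rewrite -imset_set1 -tE; apply: (valP x).
pose f (x : vertex (multipath_complex G)) : vertex (join K) := Sub (t (val x)) (tV x).
(* A vertex of the join is a tagged edge of the split graph, hence some [t e]; by [tE], [e] is then
   a vertex of the multipath complex. *)
have f_surj (y : vertex (join K)) : exists x, f x == y.
  case: y => -[i a] ya.
  have : [set a] \in matchings (split_graph G).
    move: (ya); rewrite inE => /forallP/(_ i).
    by rewrite -(imset_set1 (tag_in i)) join_part_imset.
  rewrite inE sub1set => /andP[/graph_edges_split[e ae] _].
  have te : t e = tag_in i a by rewrite ae /t (ord1 i).
  have eV : [set e] \in multipaths G by rewrite tE imset_set1 te.
  by exists (Sub e eV : vertex (multipath_complex G)); apply/eqP/val_inj; rewrite /= te.
have f_inj : injective f by move=> x y /(congr1 val)/t_inj/val_inj.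
exists f.
  (* The inverse chooses a preimage; injectivity of [f] makes it a left inverse too. *)
  exists (fun y => xchoose (f_surj y)) => [x|y]; last exact/eqP/(xchooseP (f_surj y)).
  exact/f_inj/eqP/(xchooseP (f_surj (f x))).
by move=> A; rewrite [LHS]tE -imset_comp.
Qed.
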